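(* Let $G=(V,E)$ be a graph on $N$ vertices $V=\{1,\dots,N\}$ with fixed real-valued (resp. complex-valued) orthonormal Laplacian eigenvector matrix $\Phi=[\varphi_0\ \cdots\ \varphi_{N-1}]$. Suppose graph translation on $G$ is a semigroup, i.e. there is a semigroup operation $\bullet:\{1,\dots,N\}\times\{1,\dots,N\}\to\{1,\dots,N\}$ such that $T_iT_j=T_{i\bullet j}$ for all $i,j\in\{1,\dots,N\}$. Then $\Phi=\frac{1}{\sqrt N}H$, where $H$ is a real-valued (resp. complex-valued) Hadamard matrix.
   Context: All graphs are finite, undirected, unweighted and simple (no loops, no multiple edges). The Laplacian of $G$ is $L=D-A$ ($D$ the diagonal degree matrix, $A$ the adjacency matrix), i.e. $Lf(x)=\sum_{y\sim x}(f(x)-f(y))$. Its eigenvalues are $0=\lambda_0\le\lambda_1\le\cdots\le\lambda_{N-1}$, and one fixes an orthonormal basis of eigenvectors $\varphi_0,\dots,\varphi_{N-1}$ with $L\varphi_k=\lambda_k\varphi_k$; $\Phi$ is the $N\times N$ matrix with these as columns. The graph Fourier transform of $f:V\to\mathbb{C}$ is $\hat f(\lambda_k)=\langle f,\varphi_k\rangle=\sum_{n=1}^N f(n)\varphi_k^*(n)$, where $^*$ denotes complex conjugation and the value is indexed by $k$ (not only by the number $\lambda_k$). For $i\in\{1,\dots,N\}$, the graph translation operator $T_i:\mathbb{C}^N\to\mathbb{C}^N$ is $(T_if)(n)=\sqrt N\sum_{k=0}^{N-1}\hat f(\lambda_k)\varphi_k^*(i)\varphi_k(n)$. A semigroup operation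 is an associative binary operation. A real (resp. complex) Hadamard matrix of order $N$ is an $N\times N$ real (resp. complex) matrix $H$ all of whose entries have absolute value $1$ and with $HH^*=N I$. *)

(* Defs.v *)
From mathcomp Require Import all_boot all_order all_algebra.
From mathcomp Require Export complex.
From mathcomp Require Export reals.

Set Implicit Arguments.
Unset Strict Implicit.
Unset Printing Implicit Defensive.
Import Order.TTheory GRing.Theory Num.Theory.
Local Open Scope ring_scope.

Section GraphTranslation.
Variables (R : realType) (N : nat).
Local Notation C := R[i].

(* Vertices are 0, ..., N-1; "e x y" means that x and y are adjacent. *)
Definition simple_graph (e : rel 'I_N) : Prop := symmetric e /\ irreflexive e.

Definition adjacency (e : rel 'I_N) : 'M[C]_N := \matrix_(x, y) (e x y)%:R.

Definition degree (e : rel 'I_N) (x : 'I_N) : nat := #|[set y | e x y]|.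

Definition laplacian (e : rel 'I_N) : 'M[C]_N :=
  diag_mx (\row_x (degree e x)%:R) - adjacency e.

Definition inner (f g : 'cV[C]_N) : C := \sum_(n < N) f n 0 * (g n 0)^*.

Definition laplacian_eigenbasis
    (e : rel 'I_N) (lam : 'I_N -> R) (Phi : 'M[C]_N) : Prop :=
  [/\ forall k l : 'I_N, (k <= l)%N -> lam k <= lam l,
      forall k : 'I_N,
        laplacian e *m col k Phi = (real_complex R (lam k)) *: col k Phi
    & forall k l : 'I_N, inner (col k Phi) (col l Phi) = (k == l)%:R].

(* The transform is indexed by k, not by the eigenvalue lam k, which may be
   multiple. *)
Definition graph_fourier (Phi : 'M[C]_N) (f : 'cV[C]_N) (k : 'I_N) : C :=
  inner f (col k Phi).

Definition translation (Phi : 'M[C]_N) (i : 'I_N) (f : 'cV[C]_N) : 'cV[C]_N :=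
  \col_n (sqrtC N%:R *
          \sum_(k < N) graph_fourier Phi f k * (Phi i k)^* * Phi n k).

Definition translation_semigroup (Phi : 'M[C]_N) : Prop :=
  exists2 op : 'I_N -> 'I_N -> 'I_N, associative op &
    forall i j : 'I_N,
      translation Phi i \o translation Phi j =1 translation Phi (op i j).

Definition complex_hadamard (H : 'M[C]_N) : Prop :=
  (forall i j : 'I_N, `|H i j| = 1) /\
  H *m map_mx Num.conj H^T = (N%:R)%:M.

Definition real_valued (M : 'M[C]_N) : Prop := M \is a mxOver Num.real.

Definition real_hadamard (H : 'M[C]_N) : Prop :=
  real_valued H /\ complex_hadamard H.

End GraphTranslation.

(* Main.v *)
Require Import Defs.
From mathcomp Require Import all_boot all_order all_algebra.

Import Order.TTheory GRing.Theory Num.Theory.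
Local Open Scope ring_scope.

(** Orthonormality makes each column [phi_k] of [Phi] a common eigenvector of
    all the translations, with [T_i phi_k = sqrt N * conj (phi_k i) * phi_k].
    Comparing eigenvalues in [T_i T_j = T_(op i j)] shows that, for each [k],
    the function [i |-> sqrt N * conj (phi_k i)] is multiplicative from
    [('I_N, op)] to the complex numbers, that is, a character of a finite
    semigroup.

    Values of such a character lie in the closed unit disc: if [M] is their
    largest modulus, then [M ^ 2] is again the modulus of a value, so
    [M ^ 2 <= M] ([multiplicative_norm_le1]).  On the other hand the [N]
    squared moduli add up to [N], because [phi_k] is a unit vector.  A sum of
    [N] numbers that are at most 1 equals [N] only when each of them is 1, so
    all entries of [sqrt N * Phi] have modulus 1
    ([norm_eq1_of_multiplicative]).  The Hadamard identity is then the
    unitarity of [Phi], in the form [Phi Phi^* = 1] for the rows instead of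
    the columns. *)

(** A value of maximal modulus has its square among the values, so its modulus
    cannot exceed 1. *)
Lemma multiplicative_norm_le1 {F : numDomainType} {I : finType}
    (op : I -> I -> I) (f : I -> F) :
  (forall i j, f i * f j = f (op i j)) -> forall i, `|f i| <= 1.
Proof.
move=> fM i; have real_f : {in predT, forall j, `|f j| \is Num.real}.
  by move=> j _; exact: normr_real.
have [m _ max_m] := real_arg_maxP (i0 := i) (P := predT) isT real_f.
apply: le_trans (max_m i isT) _; rewrite real_leNgt ?normr_real ?real1 //.
apply/negP => m_gt1; have := max_m (op m m) isT.
rewrite -fM normrM /=.
by rewrite ger_pMl ?(lt_trans ltr01) // => /(lt_le_trans m_gt1); rewrite ltxx.
Qed.

(** A bounded sum that attains its bound forces equality termwise. *)
Lemma norm_eq1_of_multiplicative {F : numDomainType} {I : finType}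
    (op : I -> I -> I) (f : I -> F) :
  (forall i j, f i * f j = f (op i j)) ->
  \sum_i `|f i| ^+ 2 = #|I|%:R -> forall i, `|f i| = 1.
Proof.
move=> fM sum_f i; have f_le1 := multiplicative_norm_le1 op f fM.
have defect_ge0 j : true -> 0 <= 1 - `|f j| ^+ 2.
  by move=> _; rewrite subr_ge0 exprn_ile1.
have defect_sum0 : \sum_j (1 - `|f j| ^+ 2) = 0.
  by rewrite sumrB sum_f sumr_const subrr.
have /eqP := psumr_eq0P defect_ge0 defect_sum0 isT (i := i).
by rewrite subr_eq0 eq_sym sqrp_eq1 // => /eqP.
Qed.

Section OrthonormalColumns.

Variables (R : realType) (N : nat) (Phi : 'M[R[i]]_N).
Hypothesis orthoPhi :
  forall k l : 'I_N, inner (col k Phi) (col l Phi) = (k == l)%:R.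

Lemma translationZ (i : 'I_N) (c : R[i]) (f : 'cV[R[i]]_N) :
  translation Phi i (c *: f) = c *: translation Phi i f.
Proof.
apply/matrixP => n j; rewrite !mxE mulrCA; congr (_ * _).
rewrite mulr_sumr; apply: eq_bigr => k _; rewrite !mulrA; congr (_ * _ * _).
rewrite /graph_fourier /inner mulr_sumr.
by apply: eq_bigr => m _; rewrite mxE mulrA.
Qed.

Lemma translation_col (i k : 'I_N) :
  translation Phi i (col k Phi) =
  (sqrtC N%:R * (Phi i k)^*) *: col k Phi.
Proof.
apply/matrixP => n j; rewrite !mxE -mulrA; congr (_ * _).
rewrite (bigD1 k) //= big1 => [|l l_neq_k].
  by rewrite /graph_fourier orthoPhi eqxx mul1r addr0.
by rewrite /graph_fourier orthoPhi eq_sym (negbTE l_neq_k) !mul0r.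
Qed.

Lemma col_neq0 (k : 'I_N) : col k Phi != 0.
Proof.
apply/eqP => col0; have := orthoPhi k k; rewrite col0 eqxx /inner big1.
  by move/esym/eqP; rewrite oner_eq0.
by move=> n _; rewrite mxE mul0r.
Qed.

(** The eigenvalues of [T_i \o T_j] and [T_(op i j)] at the nonzero vector
    [col k Phi] agree. *)
Lemma translation_eigenvalueM (op : 'I_N -> 'I_N -> 'I_N) :
  (forall i j,
     translation Phi i \o translation Phi j =1 translation Phi (op i j)) ->
  forall k i j : 'I_N,
    (sqrtC N%:R * (Phi i k)^*) * (sqrtC N%:R * (Phi j k)^*) =
    sqrtC N%:R * (Phi (op i j) k)^*.
Proof.
move=> TM k i j; have /eqP := TM i j (col k Phi).
rewrite /= translation_col translationZ !translation_col scalerA -subr_eq0.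
rewrite -scalerBl scaler_eq0 (negbTE (col_neq0 k)) orbF subr_eq0 mulrC.
by move/eqP.
Qed.

Lemma normC_translation_eigenvalue (i k : 'I_N) :
  `|sqrtC N%:R * (Phi i k)^*| ^+ 2 = N%:R * (Phi i k * (Phi i k)^*).
Proof.
by rewrite normrM norm_conjC exprMn -normCK ger0_norm ?sqrtC_ge0 ?ler0n ?sqrtCK.
Qed.

Lemma orthonormal_unitary : Phi *m map_mx Num.conj Phi^T = 1%:M.
Proof.
apply: mulmx1C; apply/matrixP => k l; rewrite !mxE eq_sym -orthoPhi.
by apply: eq_bigr => n _; rewrite !mxE mulrC.
Qed.

Lemma scaled_basis_hadamard :
  translation_semigroup Phi -> complex_hadamard (sqrtC N%:R *: Phi).
Proof.
move=> [op _ TM]; split=> [i k|].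
  have fM := translation_eigenvalueM op TM k.
  have := norm_eq1_of_multiplicative op _ fM; rewrite card_ord.
  move=> norm_f; rewrite mxE normrM -(norm_conjC (Phi i k)) -normrM norm_f //.
  under eq_bigr do rewrite normC_translation_eigenvalue.
  rewrite -mulr_sumr; have := orthoPhi k k; rewrite eqxx /inner.
  by under eq_bigr do rewrite !mxE; move=> ->; rewrite mulr1.
have sqrtN_norm : sqrtC N%:R * (sqrtC N%:R)^* = N%:R :> R[i].
  by rewrite -normCK ger0_norm ?sqrtC_ge0 ?ler0n ?sqrtCK.
rewrite linearZ map_mxZ -scalemxAl -scalemxAr scalerA orthonormal_unitary.
by rewrite scalemx1 sqrtN_norm.
Qed.

Lemma scaled_basisK : Phi = (sqrtC N%:R)^-1 *: (sqrtC N%:R *: Phi).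
Proof.
(* An entry index witnesses [0 < N], hence that the scalar is invertible; for
   [N = 0] there are no entries. *)
apply/matrixP => i j; rewrite !mxE mulKf // sqrtC_eq0 pnatr_eq0 -lt0n.
exact: leq_ltn_trans (ltn_ord i).
Qed.

End OrthonormalColumns.

Theorem theorem2p3 (R : realType) (N : nat) (e : rel 'I_N) (lam : 'I_N -> R)
    (Phi : 'M[R[i]]_N)
    (graph_e : simple_graph e)
    (basis_Phi : laplacian_eigenbasis e lam Phi)
    (semigroup_Phi : translation_semigroup Phi) :
  (exists H : 'M[R[i]]_N,
     complex_hadamard H /\ Phi = (sqrtC N%:R)^-1 *: H) /\
  (real_valued Phi ->
   exists H : 'M[R[i]]_N,
     real_hadamard H /\ Phi = (sqrtC N%:R)^-1 *: H).
Proof.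
case: basis_Phi => _ _ orthoPhi.
have hadamardH := scaled_basis_hadamard _ _ _ orthoPhi semigroup_Phi.
have PhiE := scaled_basisK _ _ Phi.
split=> [|realPhi]; exists (sqrtC N%:R *: Phi); split=> //.
by split=> //; apply: mxOverZ => //; rewrite sqrtC_real ?ler0n.
Qed.
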